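(* The $\exists$COVER problem is $\mathsf{PSPACE}$-hard already when restricted to non-consuming timed Petri nets.
   Context: A timed Petri net (TPN) is a tuple $\mathcal{N}=(P,T,\mathit{Var},G,\mathit{Pre},\mathit{Post})$ with finite sets of places $P$, transitions $T$ and variables $\mathit{Var}$. For each $t\in T$: the guard $G(t)$ maps each variable to an (open, half-open or closed) interval with endpoints in $\mathbb{N}\cup\{\infty\}$; $\mathit{Pre}(t)$ is a finite multiset over $P\times\mathit{Var}$; letting $\mathit{Var}(t)$ be the variables occurring in $\mathit{Pre}(t)$, $\mathit{Post}(t)$ is a finite multiset over $P\times(\{0\}\cup\mathit{Var}(t))$. All numbers are encoded in unary. A marking is a finite multiset over $P\times\mathbb{R}_{\ge0}$. For an evaluation $\pi:\mathit{Var}\to\mathbb{R}_{\ge 0}$ (with $\pi(0)=0$) satisfying $G(t)$ ($\pi(x)\in G(t)(x)$ for all $x$), let $\pi(\mathit{Pre}(t))(p,c)=\sum_{v:\pi(v)=c}\mathit{Pre}(t)(p,v)$ and analogously $\pi(\mathit{Post}(t))$. $t$ is enabled in $M$ if some such $\pi$ has $\pi(\mathit{Pre}(t))\le M$; then $M\to_t M\ominus\pi(\mathit{Pre}(t))\oplus\pi(\mathit{Post}(t))$. Time steps $M\to_d M+d$ ($d\in\mathbb{R}_{\ge0}$) increase all token ages by $d$. $\to^*$ is the reflexive-transitive closure of the union of all steps; $\mathrm{Cover}(X)$ is the set of markings $M'$ with $M\to^*M''\ge M'$ for some $M\in X$. $\mathbb{N}\cdot\{(p,0)\}$ is the set of markings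 consisting of $n\in\mathbb{N}$ tokens of age $0$ on $p$ and nothing else. $\exists$COVER: given a TPN, a place $p$ and a transition $t$, does some $M\in\mathrm{Cover}(\mathbb{N}\cdot\{(p,0)\})$ enable $t$? A TPN is non-consuming if for all $t\in T$, $p\in P$, $x\in\mathit{Var}$: $\mathit{Pre}(t)(p,x)\le 1$ and $\mathit{Pre}(t)\le\mathit{Post}(t)$. *)

(* Defs.v *)
(* MathComp world; the reals are an arbitrary [R : realType]. *)
From mathcomp Require Import all_boot all_order all_algebra.
From mathcomp Require Import finmap multiset.
From mathcomp Require Import interval_inference constructive_ereal reals.
From Stdlib Require Import Relation_Operators.

Set Implicit Arguments.
Unset Strict Implicit.
Unset Printing Implicit Defensive.

Import Order.TTheory GRing.Theory Num.Theory.

Local Open Scope mset_scope.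

(** * Timed Petri nets *)

(* An interval with endpoints in N + {oo}; the endpoint oo is [None]. *)
Record guard := Guard {
  lo : option nat; lo_closed : bool;
  hi : option nat; hi_closed : bool }.

(* In [Post], the token age 0 is represented by [None : option Var], and
   [Some x] is the variable x. *)
Record tpn := TPN {
  place : finType;
  trans : finType;
  var : finType;
  G : trans -> var -> guard;
  Pre : trans -> {mset place * var};
  Post : trans -> {mset place * option var};
  Post_var : forall t p x, (p, Some x) \in Post t ->
               [exists q, (q, x) \in Pre t] }.

Section Semantics.
Variables (R : realType) (N : tpn).

Notation age := {nonneg R}%R.
Notation marking := {mset place N * age}.

Definition endpoint (e : option nat) : \bar R :=
  if e is Some n then (n%:R)%:E%E else +oo%E.

Definition in_guard (g : guard) (c : age) : bool :=
  ((c%:num)%:E%E \in Interval (BSide (lo_closed g) (endpoint (lo g)))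
                              (BSide (~~ hi_closed g) (endpoint (hi g))))%R.

Definition valuate (V : finType) (rho : V -> age) (A : {mset place N * V}) :
    marking :=
  seq_mset [seq (pv.1, rho pv.2) | pv <- A].

Lemma valuateE (V : finType) (rho : V -> age) (A : {mset place N * V}) p c :
  valuate rho A (p, c) = \sum_(v | rho v == c) A (p, v).
Proof.
rewrite mset_seqE count_map -sum1_count.
transitivity (\sum_(pv <- A | (pv.1 == p) && (rho pv.2 == c)) 1).
  by apply: eq_bigl => -[q v]; rewrite /= xpair_eqE.
rewrite (partition_big snd (fun v => rho v == c)) /=; last by move=> ? /andP[].
apply: eq_bigr => v /eqP rv; rewrite -count_mem_mset -sum1_count.
apply: eq_bigl => -[q w]; rewrite /= xpair_eqE -andbA.
by case: (eqVneq w v) => [->|_]; rewrite ?rv ?eqxx ?andbF ?andbT.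
Qed.

Definition consumed (pi : var N -> age) (t : trans N) : marking :=
  valuate pi (Pre t).

Definition produced (pi : var N -> age) (t : trans N) : marking :=
  valuate (fun v => if v is Some x then pi x else 0%:nng)%R (Post t).

Definition enables (M : marking) (t : trans N) (pi : var N -> age) : Prop :=
  (forall x, in_guard (G t x) (pi x)) /\ consumed pi t `<=` M.

Definition enabled (M : marking) (t : trans N) : Prop :=
  exists pi, enables M t pi.

Definition delay (d : age) (M : marking) : marking :=
  seq_mset [seq (pc.1, (pc.2%:num + d%:num)%:nng%R) | pc <- M].

Inductive step (M : marking) : marking -> Prop :=
| step_trans t pi : enables M t pi ->
    step M ((M `\` consumed pi t) `+` produced pi t)
| step_time d : step M (delay d M).

Definition Cover (X : marking -> Prop) (M' : marking) : Prop :=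
  exists M M'' : marking,
    [/\ X M, clos_refl_trans _ step M M'' & M' `<=` M''].

(* The set N . {(p, 0)}. *)
Definition initial (p : place N) (M : marking) : Prop :=
  exists n : nat, M = msetn n (p, 0%:nng%R).

End Semantics.

Definition non_consuming (N : tpn) : Prop :=
  forall (t : trans N) (p : place N) (x : var N),
    Pre t (p, x) <= 1 /\ Pre t (p, x) <= Post t (p, Some x).

(** * The decision problem and the encoding of its instances *)

Record instance := Instance {
  net : tpn; inst_place : place net; inst_trans : trans net }.

Definition ECOVER (R : realType) (I : instance) : Prop :=
  exists M, Cover (initial (R := R) (inst_place I)) M /\
            enabled M (inst_trans I).

Definition nc_instance := {I : instance | non_consuming (net I)}.

Definition unary (n : nat) : seq bool := rcons (nseq n true) false.

Definition code_endpoint (e : option nat) : nat := if e is Some n then n.+1 else 0.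

Definition code_guard (g : guard) : seq nat :=
  [:: code_endpoint (lo g); nat_of_bool (lo_closed g);
      code_endpoint (hi g); nat_of_bool (hi_closed g)].

Definition code_trans (N : tpn) (t : trans N) : seq nat :=
  flatten [seq code_guard (G t x) | x <- enum (var N)]
  ++ [seq Pre t (p, x) | p <- enum (place N), x <- enum (var N)]
  ++ [seq Post t (p, v) | p <- enum (place N), v <- enum {: option (var N)}].

(* Once the cardinals are known, the length of each further block is known: the
   code determines the instance up to renaming of places, transitions and
   variables. *)
Definition code_instance (I : instance) : seq nat :=
  let N := net I in
  [:: #|place N|; #|trans N|; #|var N|]
  ++ flatten [seq code_trans t | t <- enum (trans N)]
  ++ [:: nat_of_ord (enum_rank (inst_place I));
         nat_of_ord (enum_rank (inst_trans I))].

Definition encode (I : instance) : seq bool :=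
  flatten [seq unary n | n <- code_instance I].

(** * Turing machines *)

Inductive direction := Left | Stay | Right.

(* Deterministic machine with [k] tapes, each infinite to the right only, cells
   being numbered from 0; moving left from cell 0 leaves the head there. A tape
   symbol is the blank [None], an input/output bit [Some (inl b)], or an
   auxiliary symbol [Some (inr a)]. The machine halts when [delta] is [None]. *)
Record tm (k : nat) := TM {
  state : finType;
  aux : finType;
  start : state;
  accepting : pred state;
  delta : state -> {ffun 'I_k -> option (bool + aux)} ->
          option (state * ('I_k -> option (bool + aux) * direction)) }.

Section Run.
Variables (k : nat) (M : tm k).

Notation symbol := (option (bool + aux M)).

Record config := Config {
  cur : state M;
  head_pos : 'I_k -> nat;
  tape : 'I_k -> nat -> symbol }.

Definition move (d : direction) (h : nat) : nat :=
  match d with Left => h.-1 | Stay => h | Right => h.+1 end.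

Definition next_config (c : config) : option config :=
  if delta (cur c) [ffun i => tape c i (head_pos c i)] is Some (q, act) then
    Some (Config q (fun i => move (act i).2 (head_pos c i))
                 (fun i => [eta tape c i with head_pos c i |-> (act i).1]))
  else None.

(* [run n c] is the configuration after exactly [n] steps, if it exists. *)
Definition run (n : nat) (c : config) : option config :=
  iter n (obind next_config) (Some c).

Definition holds_word (f : nat -> symbol) (w : seq bool) : Prop :=
  forall j, f j = nth None [seq Some (inl b) | b <- w] j.

Definition halts_in (c : config) (n : nat) (c' : config) : Prop :=
  run n c = Some c' /\ next_config c' = None.

End Run.

(* The input is on the first tape. *)
Definition init k (M : tm k) (w : seq bool) : config M :=
  Config (start M) (fun _ => 0)
    (fun i j => if val i == 0 then nth None [seq Some (inl b) | b <- w] j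
                else None).

(** * PSPACE-hardness *)

Definition language := seq bool -> Prop.

(* Space is the number of visited cells of a single-tape machine, input included;
   the class PSPACE does not depend on the number of tapes. *)
Definition decides_in_space (M : tm 1) (s : nat -> nat) (L : language) : Prop :=
  forall w,
    (exists n c, halts_in (init M w) n c /\ (accepting (cur c) <-> L w)) /\
    (forall n c, run n (init M w) = Some c -> forall i, head_pos c i < s (size w)).

Definition PSPACE (L : language) : Prop :=
  exists (M : tm 1) (a d : nat),
    decides_in_space M (fun n => a * n ^ d + a) L.

(* The output is read on the last tape (which is the input tape if k = 0). *)
Definition computes_in_time k (M : tm k.+1) (s : nat -> nat)
    (f : seq bool -> seq bool) : Prop :=
  forall w, exists n c,
    [/\ n <= s (size w), halts_in (init M w) n c
      & holds_word (tape c ord_max) (f w)].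

Definition polytime (f : seq bool -> seq bool) : Prop :=
  exists (k : nat) (M : tm k.+1) (a d : nat),
    computes_in_time M (fun n => a * n ^ d + a) f.

(* Hardness, under polynomial-time many-one reductions, of the problem [P] whose
   instances [x : X] are presented as the words [enc x]. *)
Definition PSPACE_hard (X : Type) (enc : X -> seq bool) (P : X -> Prop) : Prop :=
  forall L : language, PSPACE L ->
    exists f : seq bool -> X,
      polytime (fun w => enc (f w)) /\ forall w, L w <-> P (f w).

(* Main.v *)
Require Import Defs.
From mathcomp Require Import all_boot all_order all_algebra.
From mathcomp Require Import finmap multiset.
From mathcomp Require Import interval_inference constructive_ereal boolp reals.
From mathcomp Require Import zify.
From Stdlib Require Import Relation_Operators.

(* Tokens are never lost, so a token on [q] records for ever that [q] held at its
   creation time. Cell [j] of the configuration after [k] steps of a machine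
   running in space less than the period [S] is recorded by a token created at
   time [(k + 1) * S + j + 1]. The content of a cell depends on the previous
   contents of the cell and of its two neighbours, whose tokens have then ages
   [S + 1], [S] and [S - 1]: a constant number of transitions, with guards that pin
   these ages, runs the whole computation. The input is written during the first
   period, by transitions that read the age of the initial tokens. All that depends
   on the input in the net is the size of a few guards, written in unary, and one
   transition per letter, so the code of the net is printed by nested loops over
   the input. *)

Set Implicit Arguments.
Unset Strict Implicit.
Unset Printing Implicit Defensive.

Import Order.TTheory GRing.Theory Num.Theory.

Local Open Scope mset_scope.

(** * While programs and their Turing machines *)

Section Programs.
Variables (k : nat) (X : finType).

Notation symbol := (option (bool + X)).
Notation view_type := {ffun 'I_k -> symbol}.
Notation action := ('I_k -> symbol * direction).

Record memory := Memory { pos : 'I_k -> nat; cells : 'I_k -> nat -> symbol }.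

Definition view (m : memory) : view_type := [ffun i => cells m i (pos m i)].

Definition apply (a : action) (m : memory) : memory :=
  Memory (fun i => move (a i).2 (pos m i))
      (fun i => [eta cells m i with pos m i |-> (a i).1]).

Definition idle (v : view_type) : action := fun i => (v i, Stay).

Lemma apply_idle m : apply (idle (view m)) m = m.
Proof.
case: m => p t; congr Memory; apply/funext => i; apply/funext => j /=.
by rewrite ffunE; case: eqP => // ->.
Qed.

Inductive cmd :=
| Act of view_type -> action
| Seq of cmd & cmd
| While of view_type -> bool & cmd.

(** The exit is not a point but the [None] of [option (point c)]. Composition then only has to say
    where the exit of a part leads. *)
Fixpoint point (c : cmd) : finType :=
  match c with
  | Act _ => unit
  | Seq c1 c2 => (point c1 + point c2)%type
  | While _ c => option (point c)
  end.

Fixpoint entry (c : cmd) : point c :=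
  match c with
  | Act _ => tt
  | Seq c1 c2 => inl (entry c1)
  | While _ _ => None
  end.

(* The point [None] of a loop is its test, which is also where its body exits. *)
Fixpoint next (c : cmd) : point c -> view_type -> option (point c) * action :=
  match c with
  | Act f => fun _ v => (None, f v)
  | Seq c1 c2 => fun p v =>
      match p with
      | inl p => let y := next p v in
          (Some (if y.1 is Some q then inl q else inr (entry c2)), y.2)
      | inr p => let y := next p v in (omap inr y.1, y.2)
      end
  | While b c => fun p v =>
      if p is Some p then let y := next p v in (Some y.1, y.2)
      else (if b v then Some (Some (entry c)) else None, idle v)
  end.

Definition tick c (x : option (point c) * memory) : option (point c) * memory :=
  if x.1 is Some p then
    let y := next p (view x.2) in (y.1, apply y.2 x.2)
  else x.

(** Only an upper bound on the number of steps is kept, so that time bounds can be weakened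
    freely. *)
Definition reach c x n y := exists2 i, i <= n & iter i (@tick c) x = y.

Definition exec c m n m' := reach (c := c) (Some (entry c), m) n (None, m').

Lemma reach0 c x n : reach (c := c) x n x.
Proof. by exists 0. Qed.

Lemma reach1 c x y : tick x = y -> reach (c := c) x 1 y.
Proof. by exists 1. Qed.

Lemma reach_trans c x n y n' z :
  reach (c := c) x n y -> reach y n' z -> reach x (n + n') z.
Proof.
move=> [i le_in <-] [j le_jn <-]; exists (j + i).
  by rewrite addnC leq_add.
by rewrite iterD.
Qed.

Lemma reachW c x n y n' : n <= n' -> reach (c := c) x n y -> reach x n' y.
Proof. by move=> le_nn [i le_in <-]; exists i => //; apply: leq_trans le_nn. Qed.

Lemma execW c m n m' n' : n <= n' -> exec c m n m' -> exec c m n' m'.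
Proof. exact: reachW. Qed.

(** Runs a part inside a larger program. Nothing is asked of [f None]: [tick] is idle at the exit of
    the part, and its idle steps are dropped, which the upper bound allows. *)
Lemma reach_embed c c' (f : option (point c) -> option (point c')) :
    (forall p m, tick (f (Some p), m) =
       (f (tick (c := c) (Some p, m)).1, (tick (c := c) (Some p, m)).2)) ->
  forall n x m y m', reach (x, m) n (y, m') -> reach (f x, m) n (f y, m').
Proof.
move=> fP n x m y m' [i le_in] in_i; apply: (reachW le_in); move: in_i.
elim: i x m {n le_in} => [|i IHi] x m; first by case=> -> ->; apply: reach0.
rewrite iterSr; case: x => [p|].
  case E: (tick _) => [x1 m1] /IHi; apply: (@reach_trans _ _ 1).
  by apply: reach1; rewrite fP E.
by move/IHi; apply: reachW.
Qed.

Lemma exec_act f m : exec (Act f) m 1 (apply (f (view m)) m).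
Proof. exact: reach1. Qed.

Lemma exec_seq c1 c2 m n1 m1 n2 m2 :
  exec c1 m n1 m1 -> exec c2 m1 n2 m2 -> exec (Seq c1 c2) m (n1 + n2) m2.
Proof.
move=> ex1 ex2; apply: (@reach_trans (Seq c1 c2) _ _ (Some (inr (entry c2)), m1)).
  pose f x : option (point (Seq c1 c2)) :=
    Some (if x is Some q then inl q else inr (entry c2)).
  by apply: (reach_embed (f := f)) ex1.
by apply: (reach_embed (c' := Seq c1 c2) (f := omap inr)) ex2.
Qed.

(** The sequence [I] lists the memories met at the loop test. A round costs one step more than its
    body, for the test, and the final [1] is the failed test. *)
Lemma exec_while (b : view_type -> bool) c (I : nat -> memory) N T :
    (forall i, i < N -> b (view (I i)) /\ exec c (I i) T (I i.+1)) ->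
    ~~ b (view (I N)) ->
  exec (While b c) (I 0) (N * T.+1 + 1) (I N).
Proof.
move=> loopP exitP; rewrite /exec /=.
suff iterP i : i <= N ->
    reach (c := While b c) (Some None, I 0) (i * T.+1) (Some None, I i).
  apply: reach_trans (iterP _ (leqnn N)) _; apply: reach1.
  by rewrite /tick /= (negbTE exitP) apply_idle.
elim: i => [|i IHi] le_iN; first exact: reach0.
have [bi exi] := loopP i le_iN.
rewrite mulSnr; apply: reach_trans (IHi (ltnW le_iN)) _; rewrite -add1n.
apply: (@reach_trans (While b c) _ _ (Some (Some (entry c)), I i)).
  by apply: reach1; rewrite /tick /= bi apply_idle.
exact: (reach_embed (c' := While b c) (f := Some)) exi.
Qed.

Definition machine (c : cmd) : tm k :=
  @TM k (option (point c)) X (Some (entry c)) predT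
    (fun p v => if p is Some p then Some (next p v) else None).

(** The machine has no step at the exit, whereas [tick] idles there; hence it may halt in fewer
    steps than the iteration counts. *)
Lemma exec_halts c n (s : config (machine c)) m' :
    cur s = Some (entry c) -> exec c (Memory (head_pos s) (tape s)) n m' ->
  exists i s', [/\ i <= n, halts_in s i s' & tape s' =2 cells m'].
Proof.
case: s => p h t /= -> [i le_in]; move: (Some _) => x in_i.
suff [j [s' [le_ji [hs1 hs2] ts']]]: exists j s',
    [/\ j <= i, halts_in (Config (M := machine c) x h t) j s'
      & tape s' =2 cells m'].
  by exists j, s'; split=> //; apply: leq_trans le_in.
elim: i x h t in_i {le_in} => [|i IHi] x h t.
  case=> -> <-; exists 0, (Config (M := machine c) None h t).
  by split=> //; split.
rewrite iterSr; case: x => [q|] /=; last first.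
  by case/IHi=> j [s' [le_ji ? ?]]; exists j, s'; split=> //; apply: leqW.
rewrite /tick /=; case E: (next q _) => [q' a] /= /IHi.
move=> [j [s' [le_ji [hs1 hs2] ts']]]; exists j.+1, s'.
split=> //; split=> //; rewrite /run iterSr /= /next_config /=.
by rewrite -/(view (Memory h t)) E.
Qed.

End Programs.

(** * Printing by nested loops over the input *)

(** The base [n.+1] is positive, which makes powers monotone in [d] and gives closure under sum and
    product without side cases. *)
Definition polybounded (T : nat -> nat) :=
  exists a d, forall n, T n <= a * n.+1 ^ d.

Lemma polybounded_const c : polybounded (fun=> c).
Proof. by exists c, 0 => n; rewrite expn0 muln1. Qed.

Lemma polybounded_id : polybounded id.
Proof. by exists 1, 1 => n; rewrite mul1n expn1. Qed.

Lemma polybounded_add T1 T2 :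
  polybounded T1 -> polybounded T2 -> polybounded (fun n => T1 n + T2 n).
Proof.
move=> [a1 [d1 le1]] [a2 [d2 le2]]; exists (a1 + a2), (d1 + d2) => n.
rewrite mulnDl leq_add //; [apply: leq_trans (le1 n) _|apply: leq_trans (le2 n) _].
  by rewrite leq_mul // leq_pexp2l // leq_addr.
by rewrite leq_mul // leq_pexp2l // leq_addl.
Qed.

Lemma polybounded_mul T1 T2 :
  polybounded T1 -> polybounded T2 -> polybounded (fun n => T1 n * T2 n).
Proof.
move=> [a1 [d1 le1]] [a2 [d2 le2]]; exists (a1 * a2), (d1 + d2) => n.
by rewrite expnD mulnACA leq_mul.
Qed.

Lemma polybounded_monomial T :
  polybounded T -> exists a d, forall n, T n <= a * n ^ d + a.
Proof.
move=> [a [d leT]]; exists (a * 2 ^ d), d => n; apply: leq_trans (leT n) _.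
case: n => [|n] {leT}; first by rewrite exp1n muln1 -[leqLHS]muln1; nia.
rewrite -mulnA -expnMn; apply: leq_trans (leq_addr _ _).
by case: d => [|d]; rewrite ?expn0 // leq_mul // leq_exp2r //; lia.
Qed.

Ltac polybounded_tac := repeat first
  [ assumption | exact: polybounded_const | exact: polybounded_id
  | apply: polybounded_add | apply: polybounded_mul ].

Section Writer.
Variable D : nat.

Notation view_type := {ffun 'I_D.+2 -> option (bool + unit)}.
Notation cmd := (cmd D.+2 unit).
Notation memory := (memory D.+2 unit).

Definition bits (w : seq bool) : nat -> option (bool + unit) :=
  nth None [seq Some (inl b) | b <- w].

Definition marked (w : seq bool) : nat -> option (bool + unit) :=
  nth None (Some (inr tt) :: [seq Some (inl b) | b <- w]).

(* Tape 0 is the input, the last tape is the output, and the tapes 1, ..., D hold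
   a copy of the input after an end mark: their heads are the loop counters. *)
Definition snapshot (u w : seq bool) (p : nat) (h : nat -> nat)
    (out : seq bool) : memory :=
  Memory (fun i => if val i == 0 then p else
                if i == ord_max then size out else h i)
      (fun i => if val i == 0 then bits w else
                if i == ord_max then bits out else marked u).

Definition instr (mv : nat -> direction) (e : view_type -> option bool) : cmd :=
  Act (fun v i =>
    if val i == 0 then (v i, Stay)
    else if i == ord_max then
      (if e v is Some b then (Some (inl b), Right) else (v i, Stay))
    else (v i, mv i)).

Lemma eta_with_same (T : eqType) (U : Type) (f : T -> U) x :
  [eta f with x |-> f x] = f :> (T -> U).
Proof. by apply/funext => y /=; case: eqP => // ->. Qed.

Lemma eta_with_with (T : eqType) (U : Type) (f : T -> U) x a b :
  [eta [eta f with x |-> a] with x |-> b] = [eta f with x |-> b] :> (T -> U).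
Proof. by apply/funext => y /=; case: eqP. Qed.

Lemma eta_with_id (T : eqType) (U : Type) (f : T -> U) x y :
  f x = y -> [eta f with x |-> y] = f :> (T -> U).
Proof. by move=> <-; apply: eta_with_same. Qed.

Lemma bits_rcons w b :
  [eta bits w with size w |-> Some (inl b)] = bits (rcons w b) :> (nat -> _).
Proof.
apply/funext => j; rewrite /= /bits map_rcons nth_rcons size_map.
case: ltngtP => // /ltnW le_wj; by rewrite nth_default // size_map.
Qed.

Lemma exec_instr mv e u w p h out :
  exec (instr mv e) (snapshot u w p h out) 1
    (snapshot u w p (fun i => move (mv i) (h i))
      (out ++ seq_of_opt (e (view (snapshot u w p h out))))).
Proof.
set v := view _; rewrite /instr.
rewrite [X in exec _ _ _ X](_ : _ = apply (fun i =>
    if val i == 0 then (v i, Stay)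
    else if i == ord_max then
      (if e v is Some b then (Some (inl b), Right) else (v i, Stay))
    else (v i, mv i)) (snapshot u w p h out)); first exact: exec_act.
rewrite /apply /snapshot; congr Memory; apply/funext => i /=.
  case: eqP => //= _; case: eqP => //= _.
  by case: (e v) => [b|] /=; rewrite ?cats0 ?cats1 ?size_rcons.
case: (eqVneq (val i) 0) => i0 /=.
  by rewrite eta_with_id // /v ffunE /= i0 eqxx.
case: (eqVneq i ord_max) => im /=; last first.
  by rewrite eta_with_id // /v ffunE /= (negbTE i0) (negbTE im).
case: (e v) => [b|] /=; first by rewrite bits_rcons cats1.
rewrite cats0 eta_with_id //.
by rewrite /v ffunE /= (negbTE i0) im eqxx.
Qed.

Lemma exec_move mv u w p h out :
  exec (instr mv (fun=> None)) (snapshot u w p h out) 1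
    (snapshot u w p (fun i => move (mv i) (h i)) out).
Proof. by have := exec_instr mv (fun=> None) u w p h out; rewrite /= cats0. Qed.

Definition seen (i : nat) (v : view_type) := v (inord i).

Lemma seen_snapshot i u w p h out :
  0 < i <= D -> seen i (view (snapshot u w p h out)) = marked u (h i).
Proof.
move=> /andP[i_gt0 le_iD]; rewrite /seen /snapshot ffunE /=.
have i_ltD : i < D.+2 by lia.
rewrite -val_eqE /= inordK // (negbTE (lt0n_neq0 i_gt0)).
by case: eqP => // iD; lia.
Qed.

Definition is_mark (s : option (bool + unit)) :=
  if s is Some (inr _) then true else false.

Definition is_bit (s : option (bool + unit)) :=
  if s is Some (inl _) then true else false.

Lemma is_mark_marked u p : is_mark (marked u p) = (p == 0).
Proof.
case: p => //= p; rewrite /marked /=.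
by elim: u p => [|b u IHu] [|p] //=; apply: IHu.
Qed.

Lemma is_bit_marked u p : is_bit (marked u p) = (0 < p <= size u).
Proof.
case: p => //= p; rewrite /marked /=.
by elim: u p => [|b u IHu] [|p] //=; apply: IHu.
Qed.

(* The first [e] loop heads are free for use by the program, which must restore
   them; the positions of the others are parameters of the printed word. *)
Definition emits e (B : seq bool -> (nat -> nat) -> seq bool) :=
  exists c : cmd, exists2 T, polybounded T &
    forall w h out, (forall i, 0 < i <= e -> h i = 0) ->
      (forall i, h i <= size w) ->
    exec c (snapshot w w (size w) h out) (T (size w))
      (snapshot w w (size w) h (out ++ B w h)).

Lemma emitsW e e' B : e <= e' -> emits e B -> emits e' B.
Proof.
move=> le_ee [c [T polyT execP]]; exists c, T => // w h out h0 leh.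
by apply: execP => // i /andP[i_gt0 le_ie]; rewrite h0 // i_gt0 (leq_trans le_ie).
Qed.

Lemma eq_emits e B B' :
  (forall w h, (forall i, 0 < i <= e -> h i = 0) -> (forall i, h i <= size w) ->
    B w h = B' w h) -> emits e B -> emits e B'.
Proof.
move=> eqB [c [T polyT execP]]; exists c, T => // w h out h0 leh.
by rewrite -eqB //; apply: execP.
Qed.

Lemma emits_cat e B1 B2 :
  emits e B1 -> emits e B2 -> emits e (fun w h => B1 w h ++ B2 w h).
Proof.
move=> [c1 [T1 poly1 exec1]] [c2 [T2 poly2 exec2]].
exists (Seq c1 c2), (fun n => T1 n + T2 n); first exact: polybounded_add.
move=> w h out h0 leh; rewrite catA.
by apply: exec_seq; [apply: exec1 | apply: exec2].
Qed.

Lemma emits_instr e (g : view_type -> option bool) B :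
  (forall w h out, seq_of_opt (g (view (snapshot w w (size w) h out))) = B w h) ->
  emits e B.
Proof.
move=> gB; exists (instr (fun=> Stay) g), (fun=> 1).
  exact: polybounded_const.
by move=> w h out _ _; rewrite -(gB w h out); apply: exec_instr.
Qed.

(** The list [r] is fixed, so this loop is unrolled in the program text; loops over the input are
    the matter of [emits_for_each]. *)
Lemma emits_flatten e (I : Type) (r : seq I) B :
  (forall x, emits e (B x)) ->
  emits e (fun w h => flatten [seq B x w h | x <- r]).
Proof.
move=> BP; elim: r => [|x r IHr] /=; last exact: emits_cat.
exact: (@emits_instr _ (fun=> None)).
Qed.

Definition letter (s : option (bool + unit)) := s == Some (inl true).

Lemma flatten_onth (T : Type) (s : seq T) n :
  size s <= n -> flatten [seq seq_of_opt (onth s i) | i <- iota 0 n] = s.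
Proof.
elim: s n => [|x s IHs] [|n] //= le_sn.
  by rewrite (iotaDl 1 0) -map_comp; elim: (iota 0 n) => //= -[].
by rewrite (iotaDl 1 0) -map_comp /= IHs.
Qed.

(** One instruction writes at most one bit, so the word is printed bit by bit. The number [n] of
    instructions fits both possible words; past the end of the shorter one [onth] gives [None] and
    nothing is written. *)
Lemma emits_letter e g : 0 < D ->
  emits e (fun w h => g (letter (marked w (h D)))).
Proof.
move=> D_gt0; set n := maxn (size (g true)) (size (g false)).
pose B i w h := seq_of_opt (onth (g (letter (marked w (h D)))) i).
apply: (@eq_emits _ (fun w h => flatten [seq B i w h | i <- iota 0 n])).
  move=> w h _ _; apply: flatten_onth.
  by case: letter; rewrite leq_max leqnn ?orbT.
apply: emits_flatten => i.
apply: (@emits_instr _ (fun v => onth (g (letter (seen D v))) i)) => w h out.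
by rewrite seen_snapshot // D_gt0 leqnn.
Qed.

Lemma emits_const e s : 0 < D -> emits e (fun _ _ => s).
Proof. exact: (emits_letter _ (fun=> s)). Qed.

Definition shift (i : nat) (d : direction) : nat -> direction :=
  fun j => if j == i then d else Stay.

Lemma shiftE i d h : (fun j => move (shift i d j) (h j)) =
  [eta h with i |-> move d (h i)] :> (nat -> nat).
Proof. by apply/funext => j; rewrite /shift /=; case: eqP => // ->. Qed.

(** The head of tape [e.+1] visits the letters, at positions 1 to [size w], then returns to the end
    mark, so that the loop can itself be nested. *)
Lemma emits_for_each e B : e < D -> emits e B ->
  emits e.+1 (fun w h =>
    flatten [seq B w [eta h with e.+1 |-> p.+1] | p <- iota 0 (size w)]).
Proof.
move=> lt_eD [c [T polyT execP]].
exists (Seq (instr (shift e.+1 Right) (fun=> None))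
       (Seq (While (fun v => is_bit (seen e.+1 v))
               (Seq c (instr (shift e.+1 Right) (fun=> None))))
            (While (fun v => ~~ is_mark (seen e.+1 v))
               (instr (shift e.+1 Left) (fun=> None))))).
exists (fun n => 1 + (n * (T n + 2) + 1) + (n * 2 + 3)).
  by polybounded_tac.
move=> w h out h0 leh; set n := size w.
apply: (@execW _ _ _ _ (1 + ((n * (T n + 1).+1 + 1) + (n.+1 * 2 + 1)))).
  by nia.
have i_in : 0 < e.+1 <= D by [].
pose at_ j : nat -> nat := [eta h with e.+1 |-> j].
pose out_ j := out ++ flatten [seq B w (at_ p.+1) | p <- iota 0 j].
have at0 : at_ 0 = h by apply: eta_with_id; rewrite h0 //= leqnn.
have atS d j : (fun i => move (shift e.+1 d i) (at_ j i)) = at_ (move d j).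
  by rewrite shiftE /at_ eta_with_with /= eqxx.
apply: exec_seq; first exact: exec_move.
rewrite -[in X in snapshot _ _ _ X]at0 atS /=.
apply: exec_seq.
  have out0 : out_ 0 = out by rewrite /out_ /= cats0.
  rewrite -[in X in exec _ X]out0.
  have := @exec_while _ _ (fun v => is_bit (seen e.+1 v))
    (Seq c (instr (shift e.+1 Right) (fun=> None)))
    (fun j => snapshot w w n (at_ j.+1) (out_ j)) n (T n + 1).
  apply => [j lt_jn|].
    split; first by rewrite seen_snapshot // is_bit_marked /at_ /= eqxx.
    apply: (@exec_seq _ _ _ _ _ _ (snapshot w w n (at_ j.+1) (out_ j.+1))).
      have -> : out_ j.+1 = out_ j ++ B w (at_ j.+1).
        by rewrite /out_ -[in LHS]addn1 iotaD map_cat flatten_cat /= cats0 catA.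
      apply: execP => i; rewrite /at_ /=; last by case: eqP.
      by case: eqP => [-> | _ /andP[i0 ie]]; rewrite ?ltnn // h0 // i0 ltnW.
    rewrite -[at_ j.+2](atS Right j.+1); exact: exec_move.
  by rewrite seen_snapshot // is_bit_marked /at_ /= eqxx ltnn.
(* The first loop stops on the blank at position [n.+1], so [n.+1] moves bring the head back to the
   mark. *)
have := @exec_while _ _ (fun v => ~~ is_mark (seen e.+1 v))
    (instr (shift e.+1 Left) (fun=> None))
    (fun j => snapshot w w n (at_ (n.+1 - j)) (out_ n)) n.+1 1.
rewrite subn0 subnn at0 => H; apply: H => [j lt_jn|].
  split.
    by rewrite seen_snapshot // is_mark_marked /at_ /= eqxx -lt0n subn_gt0.
  rewrite subnS -[at_ _.-1](atS Left); exact: exec_move.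
by rewrite seen_snapshot // is_mark_marked h0 //= leqnn.
Qed.

Lemma emits_pow a e : e <= D -> 0 < D ->
  emits e (fun w _ => nseq (a * size w ^ e) true).
Proof.
move=> le_eD D_gt0; elim: e le_eD => [|e IHe] le_eD /=.
  by apply: eq_emits (emits_const _ (nseq a true) D_gt0) => w h _ _; rewrite muln1.
apply: eq_emits (emits_for_each le_eD (IHe (ltnW le_eD))) => w h _ _ /=.
rewrite expnS mulnCA; move: (a * _) => b.
by elim: (size w) 0 => //= n IHn i; rewrite IHn mulSn nseqD.
Qed.

End Writer.

(* The head of tape [D.+2] walks to the end mark and back, while the head of tape
   [D.+1] counts the distance. *)
Lemma emits_head_twice D s :
  emits D.+2 D.+1 (fun w h => nseq (h D.+2) true ++ s ++ nseq (h D.+2) true).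
Proof.
pose D2 := D.+2.
have [c [T polyT execP]] := emits_const 0 s (ltn0Sn D.+1).
pose out_move i :=
  if i == D.+2 then Left else if i == D.+1 then Right else Stay.
pose back_move i :=
  if i == D.+2 then Right else if i == D.+1 then Left else Stay.
exists (Seq (While (fun v => ~~ is_mark (seen (D := D2) D.+2 v))
               (instr out_move (fun=> Some true)))
       (Seq c
            (While (fun v => ~~ is_mark (seen (D := D2) D.+1 v))
               (instr back_move (fun=> Some true))))).
exists (fun n => n * 2 + 1 + (T n + (n * 2 + 1))); first by polybounded_tac.
move=> w h out h0 leh; set n := size w; set m := h D.+2.
have le_mn : m <= n by apply: leh.
apply: (@execW _ _ _ _ (m * 2 + 1 + (T n + (m * 2 + 1)))); first by nia.
pose at_ i j : nat -> nat := [eta h with D.+2 |-> i, D.+1 |-> j].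
have at0 : at_ m 0 = h.
  apply/funext => i; rewrite /at_ /=; case: eqP => [-> //|_].
  by case: eqP => // ->; rewrite h0 //= leqnn.
have in1 : 0 < D.+1 <= D2 by rewrite /= leqnSn.
have in2 : 0 < D.+2 <= D2 by rewrite /= leqnn.
have neqD : (D.+1 == D.+2) = false by lia.
apply: (@exec_seq _ _ _ _ _ _ (snapshot D2 w w n (at_ 0 m) (out ++ nseq m true))).
  have := @exec_while _ _ (fun v => ~~ is_mark (seen (D := D2) D.+2 v))
    (instr out_move (fun=> Some true))
    (fun j => snapshot D2 w w n (at_ (m - j) j) (out ++ nseq j true)) m 1.
  rewrite subn0 subnn at0 cats0 => H; apply: H => [j lt_jm|].
    split.
      by rewrite seen_snapshot // is_mark_marked /at_ /= eqxx -lt0n subn_gt0.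
    rewrite [nseq j.+1 _](_ : _ = nseq j true ++ [:: true]) ?catA; last first.
      by rewrite -addn1 nseqD.
    have -> : at_ (m - j.+1) j.+1 = fun i => move (out_move i) (at_ (m - j) j i).
      apply/funext => i; rewrite /at_ /out_move /=; case: eqP => _ /=.
        by rewrite subnS.
      by case: eqP.
    exact: exec_instr.
  by rewrite seen_snapshot // is_mark_marked /at_ /= eqxx.
apply: (@exec_seq _ _ _ _ _ _
  (snapshot D2 w w n (at_ 0 m) ((out ++ nseq m true) ++ s))).
  apply: execP => [[]//|i].
  by rewrite /at_ /=; case: eqP => // _; case: eqP.
have := @exec_while _ _ (fun v => ~~ is_mark (seen (D := D2) D.+1 v))
    (instr back_move (fun=> Some true))
    (fun j => snapshot D2 w w n (at_ j (m - j))
       (((out ++ nseq m true) ++ s) ++ nseq j true)) m 1.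
rewrite subn0 subnn at0 cats0 -!catA => H; apply: H => [j lt_jm|].
  split.
    by rewrite seen_snapshot // is_mark_marked /at_ /= neqD eqxx -lt0n subn_gt0.
  rewrite [nseq j.+1 _](_ : _ = nseq j true ++ [:: true]); last first.
    by rewrite -addn1 nseqD.
  have -> : at_ j.+1 (m - j.+1) = fun i => move (back_move i) (at_ j (m - j) i).
    apply/funext => i; rewrite /at_ /back_move /=; case: eqP => //= _.
    by case: eqP => //; rewrite subnS.
  rewrite !catA; exact: exec_instr.
by rewrite seen_snapshot // is_mark_marked -/m h0 //= leqnn.
Qed.

(** * Copying the input to the loop tapes *)

Section Setup.
Variable D : nat.
Hypothesis D_gt0 : 0 < D.

Definition put_marks : cmd D.+2 unit :=
  Act (fun v i => if (val i == 0) || (i == ord_max) then (v i, Stay)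
                  else (Some (inr tt), Right)).

Definition copy_letter : cmd D.+2 unit :=
  Act (fun v i => if val i == 0 then (v i, Right)
                  else if i == ord_max then (v i, Stay) else (v ord0, Right)).

(** The loop heads move in lockstep, so the test of the rewinding loop looks at tape 1 alone. The
    input head stays at the end of the input. *)
Definition setup : cmd D.+2 unit :=
  Seq put_marks
 (Seq (While (fun v => is_bit (v ord0)) copy_letter)
      (While (fun v => ~~ is_mark (seen 1 v)) (instr (fun=> Left) (fun=> None)))).

Definition blank_memory (w : seq bool) : memory D.+2 unit :=
  Memory (fun=> 0) (fun i => if val i == 0 then bits w else fun=> None).

Lemma exec_put_marks w :
  exec put_marks (blank_memory w) 1 (snapshot D [::] w 0 (fun=> 1) [::]).
Proof.
rewrite /put_marks.
rewrite [X in exec _ _ _ X](_ : _ = apply (fun i =>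
   if (val i == 0) || (i == ord_max) then (view (blank_memory w) i, Stay)
   else (Some (inr tt), Right)) (blank_memory w)); first exact: exec_act.
rewrite /apply /snapshot; congr Memory; apply/funext => i /=.
  by case: eqP => //= _; case: eqP.
rewrite ffunE /=; case: eqP => [_|_] /=; first by rewrite eta_with_id.
apply/funext => j /=; case: eqP => [_|_] /=.
  by rewrite /bits nth_nil; case: eqP.
by case: j => [|[|j]].
Qed.

Lemma exec_copy_letter w j : j < size w ->
  exec copy_letter (snapshot D (take j w) w j (fun=> j.+1) [::]) 1
    (snapshot D (take j.+1 w) w j.+1 (fun=> j.+2) [::]).
Proof.
move=> lt_jw; set m := snapshot _ _ _ j _ _; rewrite /copy_letter.
rewrite [X in exec _ _ _ X](_ : _ = apply (fun i =>
   if val i == 0 then (view m i, Right)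
   else if i == ord_max then (view m i, Stay) else (view m ord0, Right)) m);
  first exact: exec_act.
rewrite /apply /snapshot; congr Memory; apply/funext => i /=.
  by case: eqP => //= _; case: eqP.
rewrite !ffunE /=; case: eqP => [_|_] /=; first by rewrite eta_with_id.
case: eqP => [_|_]; first by rewrite eta_with_id.
rewrite (take_nth false lt_jw) /= /marked map_rcons -rcons_cons.
apply/funext => p; rewrite nth_rcons /= size_map size_take lt_jw.
case: (ltngtP p j.+1) => // [lt_jp|_].
  by rewrite nth_default //= size_map size_take lt_jw ltnW.
by rewrite /bits (nth_map false).
Qed.

Lemma exec_setup : exists2 T, polybounded T &
  forall w, exec setup (blank_memory w) (T (size w))
    (snapshot D w w (size w) (fun=> 0) [::]).
Proof.
exists (fun n => 1 + (n * 2 + 1 + (n * 2 + 3))); first by polybounded_tac.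
move=> w; set n := size w.
apply: exec_seq (exec_put_marks w) _; apply: exec_seq.
  have := @exec_while _ _ (fun v => is_bit (v ord0)) copy_letter
    (fun j => snapshot D (take j w) w j (fun=> j.+1) [::]) n 1.
  rewrite take0 take_size => H; apply: H => [j lt_jn|].
    split; last exact: exec_copy_letter.
    by rewrite ffunE /= /bits (nth_map false).
  by rewrite ffunE /= /bits nth_default // size_map.
have := @exec_while _ _ (fun v => ~~ is_mark (seen 1 v))
    (instr (fun=> Left) (fun=> None))
    (fun j => snapshot D w w n (fun=> n.+1 - j) [::]) n.+1 1.
rewrite subn0 subnn => H; apply: (@execW _ _ _ _ (n.+1 * 2 + 1)); first by lia.
apply: H => [j lt_jn|]; last by rewrite seen_snapshot // is_mark_marked.
rewrite seen_snapshot // is_mark_marked -lt0n subn_gt0; split=> //.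
rewrite [in X in exec _ _ _ X]subnS; exact: exec_move.
Qed.

Lemma emits_polytime B : emits D D B -> polytime (fun w => B w (fun=> 0)).
Proof.
move=> [c [T2 poly2 exec2]]; have [T1 poly1 exec1] := exec_setup.
have [a [d le_ad]] := polybounded_monomial (polybounded_add poly1 poly2).
exists D.+1, (machine (Seq setup c)), a, d => w.
pose out := snapshot D w w (size w) (fun=> 0) (B w (fun=> 0)).
have : exec (Seq setup c) (blank_memory w) (T1 (size w) + T2 (size w)) out.
  apply: exec_seq (exec1 w) _.
  by apply: (exec2 w (fun=> 0) [::]).
rewrite (_ : blank_memory w = Memory (head_pos (init (machine (Seq setup c)) w))
                              (tape (init (machine (Seq setup c)) w))).
  case/exec_halts => // n [s [le_n halts_s ts]]; exists n, s; split=> //.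
    exact: leq_trans (le_ad _).
  by move=> j; rewrite ts /= eqxx.
rewrite /blank_memory /=; congr Memory; apply/funext => i; apply/funext => j.
by case: eqP.
Qed.

End Setup.

(** * Runs as doubly indexed contents *)

Section Rows.
Variable M : tm 1.

Notation symbol := (option (bool + aux M)).

(* A content is a tape cell, with the state of the machine if the head is there, or
   one of [launch], the place of the initial tokens, [border], on the left of cell
   0, and [accept], read by the transition to be enabled. *)
Notation content := (option (state M) * symbol + option bool)%type.

Definition launch : content := inr None.
Definition border : content := inr (Some false).
Definition accept : content := inr (Some true).
Definition blank : content := inl (None, None).

Definition delta1 (q : state M) (s : symbol) :
    option (state M * (symbol * direction)) :=
  if delta q [ffun=> s] is Some (q', act) then Some (q', act ord0) else None.

(** [launch] behaves like a head moving right in the start state: it puts the head on cell 0 in row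
    1. *)
Definition from_left (l : content) : option (state M) :=
  match l with
  | inr None => Some (start M)
  | inl (Some q, s) =>
      if delta1 q s is Some (q', (_, Right)) then Some q' else None
  | _ => None
  end.

Definition from_right (r : content) : option (state M) :=
  if r is inl (Some q, s) then
    if delta1 q s is Some (q', (_, Left)) then Some q' else None
  else None.

(** One step of the machine as a local rule. A head on cell 0 recognizes the edge by its left
    neighbour [inr _] and stays there on a left move. A halting head turns into [accept] or
    disappears. *)
Definition update (l c r : content) : content :=
  match c with
  | inr None => border
  | inr (Some _) => c
  | inl (None, s) =>
      inl (if from_left l is Some q then Some q else from_right r, s)
  | inl (Some q, s) =>
      match delta1 q s with
      | None => if accepting q then accept else inl (None, s)
      | Some (q', (s', Stay)) => inl (Some q', s')
      | Some (q', (s', Left)) => inl (if l is inr _ then Some q' else None, s')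
      | Some (q', (s', Right)) => inl (None, s')
      end
  end.

Variables (w : seq bool) (S : nat).

(* Row 0 is the input after [launch]; row [k.+1] shows the configuration reached
   after [k] steps, after [border]. *)
Fixpoint row (k j : nat) : content :=
  if k is k'.+1 then
    update (row k' j.-1) (row k' j) (if j.+1 < S then row k' j.+1 else border)
  else if j is i.+1 then inl (None, nth None [seq Some (inl b) | b <- w] i)
  else launch.

Lemma rowS k j : row k.+1 j =
  update (row k j.-1) (row k j) (if j.+1 < S then row k j.+1 else border).
Proof. by []. Qed.

Lemma row0 k : row k 0 = if k is 0 then launch else border.
Proof. by elim: k => //= -[|k] ->. Qed.

(** [update] never yields [launch], so the age of a token on this place tells the time elapsed since
    the start. *)
Lemma row_launch k j : row k j = launch -> k = 0 /\ j = 0.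
Proof.
case: k => [|k]; first by case: j.
rewrite /= /update; case: (row k j) => [[[q|] s]|[b|]] //.
by case: (delta1 q s) => [[q' [s' []]]|] //; case: ifP.
Qed.

Arguments row : simpl never.

Definition cell_at (c : config M) (j : nat) : content :=
  inl (if head_pos c ord0 == j then Some (cur c) else None, tape c ord0 j).

(** * The rows follow the run of the machine *)

Section Simulation.
Hypothesis space :
  forall k c, run k (init M w) = Some c -> (head_pos c ord0).+2 < S.

Lemma next_config1 c : next_config c =
  if delta1 (cur c) (tape c ord0 (head_pos c ord0)) is Some (q, sd) then
    Some (Config q (fun i => move sd.2 (head_pos c i))
                 (fun i => [eta tape c i with head_pos c i |-> sd.1]))
  else None.
Proof.
rewrite /next_config /delta1.
have -> : [ffun i => tape c i (head_pos c i)] =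
          [ffun=> tape c ord0 (head_pos c ord0)].
  by apply/ffunP => i; rewrite !ffunE ord1.
case: (delta _ _) => [[q act]|] //.
congr (Some (Config _ _ _)); apply/funext => i; by rewrite ord1.
Qed.

Lemma runS k c' : run k.+1 (init M w) = Some c' ->
  exists2 c, run k (init M w) = Some c & next_config c = Some c'.
Proof. by rewrite /run iterS; case: (iter _ _ _) => //= c; exists c. Qed.

Lemma row_left c k j : (forall j, j.+1 < S -> row k.+1 j.+1 = cell_at c j) ->
  j.+1 < S -> from_left (row k.+1 j) =
  if (head_pos c ord0).+1 == j then
    if delta1 (cur c) (tape c ord0 (head_pos c ord0)) is Some (q', (_, Right))
    then Some q' else None
  else None.
Proof.
move=> rowk lt_jS; case: j lt_jS => [|j] lt_jS; first by rewrite row0.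
rewrite rowk 1?ltnW // /from_left /cell_at eqSS.
by case: eqP => // ->.
Qed.

(** By the space bound the head never reaches the last column, so [border] beyond the right edge
    agrees with the blank tape there. *)
Lemma row_right c k j : (head_pos c ord0).+2 < S ->
  (forall j, j.+1 < S -> row k.+1 j.+1 = cell_at c j) ->
  from_right (if j.+2 < S then row k.+1 j.+2 else border) =
  if head_pos c ord0 == j.+1 then
    if delta1 (cur c) (tape c ord0 (head_pos c ord0)) is Some (q', (_, Left))
    then Some q' else None
  else None.
Proof.
move=> lt_hS rowk; case: ifP => [lt_jS|]; last first.
  by move=> ge_jS; case: eqP => // hj; lia.
rewrite rowk // /from_right /cell_at.
by case: eqP => // ->.
Qed.

(** Rows are one ahead of steps because row 0 has no head, and columns one ahead of cells because
    column 0 is the border. *)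
Lemma row_run k c j : run k (init M w) = Some c -> j.+1 < S ->
  row k.+1 j.+1 = cell_at c j.
Proof.
elim: k c j => [|k IHk] c j.
  case=> <- lt_jS; rewrite rowS /cell_at /= {1 2}/row /=.
  by case: j lt_jS => [|j] lt_jS //=; rewrite /row; case: ifP.
move=> /[dup] run_c' /runS[c0 run_c0]; rewrite next_config1 => next_c lt_jS.
have lt_hS := space run_c0; have lt_hS' := space run_c'.
have rowk i := @IHk c0 i run_c0.
rewrite rowS rowk //.
rewrite /update {1}/cell_at.
case D : (delta1 _ _) next_c => [[q [s d]]|] //= [<-] /=.
case: (eqVneq (head_pos c0 ord0) j) => [hj|neq_hj].
  rewrite hj in D; rewrite D /cell_at /= hj eqxx.
  case: d {D} => /=; rewrite ?eqxx ?(gtn_eqF (ltnSn j)) //.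
  case: j hj lt_jS => [|j] hj lt_jS; first by rewrite row0 eqxx.
  rewrite rowk 1?ltnW // /cell_at /=.
  by rewrite (ltn_eqF (ltnSn j)).
rewrite (row_left rowk) // (row_right _ lt_hS rowk) // D /cell_at /=.
rewrite [j == _]eq_sym (negbTE neq_hj) /=.
congr (inl (_, _)).
by case: d D => D /=; do ![case: eqP => //= ?]; lia.
Qed.

Definition calm (x : content) :=
  match x with inr (Some false) | inl (None, _) => true | _ => false end.

(** With neither a head nor [launch] in the row, no column can receive a head or become [accept]: a
    rejecting halt is final. *)
Lemma calm_row k j : (forall j, j < S -> calm (row k.+1 j)) ->
  j < S -> calm (row k.+2 j).
Proof.
move=> calm_k lt_jS; rewrite rowS.
have := calm_k j lt_jS; have := calm_k j.-1 (leq_ltn_trans (leq_pred j) lt_jS).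
have : calm (if j.+1 < S then row k.+1 j.+1 else border).
  by case: ifP => // /calm_k.
case: (if _ then _ else _) => [[[q|] s]|[[]|]] //= _.
all: case: (row k.+1 j.-1) => [[[q2|] s2]|[[]|]] //= _.
all: by case: (row k.+1 j) => [[[q'|] s']|[[]|]].
Qed.

(** Row [m.+1] shows the halting configuration, so an accepting head becomes [accept] in row [m.+2].
    A rejecting head vanishes: rows from [m.+2] on are calm, and the earlier ones show the input or
    configurations. *)
Lemma accept_row m c : halts_in (init M w) m c ->
  accepting (cur c) <-> exists k j, j < S /\ row k j = accept.
Proof.
move=> [run_c]; rewrite next_config1 => halt_c.
have lt_hS := space run_c.
have rowm j := @row_run m c j run_c.
have D : delta1 (cur c) (tape c ord0 (head_pos c ord0)) = None.
  by case: (delta1 _ _) halt_c => // -[].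
split=> [acc|[k [j [lt_jS accj]]]].
  exists m.+2, (head_pos c ord0).+1; split; first exact: ltnW.
  by rewrite rowS (rowm _ (ltnW lt_hS)) /update /cell_at eqxx D acc.
apply: contraPT accj => nacc.
have calm_m i : calm (row (m.+2 + i) j).
  elim: i {k} j lt_jS => [|i IHi] j lt_jS; last by rewrite addnS calm_row.
  rewrite addn0; case: j lt_jS => [|j] lt_jS; first by rewrite row0.
  rewrite rowS (rowm j) // /update {1}/cell_at.
  case: eqP => [<-|_]; first by rewrite D (negbTE nacc).
  by rewrite (row_left rowm) // (row_right _ lt_hS rowm) // D; do 2?case: ifP.
have [le_mk|lt_km] := leqP m.+2 k.
  by move/(congr1 calm); rewrite -(subnKC le_mk) calm_m.
case: k lt_km => [|k] lt_km; first by case: j {calm_m} lt_jS.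
case: j lt_jS {calm_m} => [|j] lt_jS; first by rewrite row0.
(* A run that is defined for [m] steps is defined for every [k <= m]. *)
have [c' run_c'] : exists c', run k (init M w) = Some c'.
  rewrite ltnS ltnS in lt_km; move: run_c; rewrite -(subnK lt_km) /run iterD.
  case: (iter k _ _) => [c' _|]; first by exists c'.
  by rewrite [iter _ _ _](_ : _ = None); last by elim: (m - k) => //= i ->.
by rewrite (row_run run_c').
Qed.

End Simulation.

Hypothesis S_gt1 : 1 < S.

Definition content_at (m : nat) : content := row (m %/ S) (m %% S).

(** The rows are laid end to end. After the last column comes column 0 of the next row, which is
    [border], as [row] assumes at its right edge; and column 0 is updated without regard to its
    neighbours. *)
Lemma content_atS m : content_at (m + S) =
  update (content_at m.-1) (content_at m) (content_at m.+1).
Proof.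
have S_gt0 := ltnW S_gt1.
rewrite /content_at divnDr // divnn S_gt0 addn1 modnDr.
set k := m %/ S; set j := m %% S; rewrite rowS.
have lt_jS : j < S by rewrite ltn_mod.
have defm : m = k * S + j by rewrite -divn_eq.
case: (posnP j) => [-> | j_gt0]; first by rewrite row0; case: k {defm}.
have Ej i : i < S -> row ((k * S + i) %/ S) ((k * S + i) %% S) = row k i.
  by move=> lt_iS; rewrite divnMDl // modnMDl divn_small // modn_small // addn0.
have -> : m.-1 = k * S + j.-1 by lia.
have -> : m.+1 = k * S + j.+1 by lia.
rewrite Ej //; last exact: leq_ltn_trans (leq_pred j) lt_jS.
case: ltnP => [lt_j1S | le_Sj1]; first by rewrite Ej.
have -> : j.+1 = S by apply/eqP; rewrite eqn_leq lt_jS.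
by rewrite divnMDl // modnMDl divnn modnn S_gt0 row0 addn1.
Qed.

Lemma content_at_launch m : content_at m = launch -> m = 0.
Proof. by move/row_launch=> [k0 j0]; rewrite (divn_eq m S) k0 j0. Qed.

Lemma content_at0 : content_at 0 = launch.
Proof. by rewrite /content_at div0n mod0n. Qed.

Lemma content_at_input m : m.+1 < S ->
  content_at m.+1 = inl (None, nth None [seq Some (inl b) | b <- w] m).
Proof. by move=> lt_mS; rewrite /content_at divn_small // modn_small. Qed.

End Rows.

(** * The net *)

Section Net.
Variables (M : tm 1) (w : seq bool) (S : nat).

Notation symbol := (option (bool + aux M)).
Notation content := (option (state M) * symbol + option bool)%type.
Notation transition := (content * content * content + option 'I_(size w))%type.

Definition exactly (m : nat) : guard := Guard (Some m) true (Some m) true.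
Definition any_age : guard := Guard (Some 0) true None false.

(** Left neighbours are recorded one time unit earlier, so the left token is the older one. *)
Definition older : 'I_3 := ord0.
Definition middle : 'I_3 := inord 1.
Definition newer : 'I_3 := inord 2.

(** A single transition writes all the blanks that follow the input, so its guard is a whole
    interval; it can then fire at non-integer times too. *)
Definition guards (t : transition) : seq guard :=
  match t with
  | inl _ => [:: exactly S.+1; exactly S; exactly S.-1]
  | inr None =>
      [:: any_age; Guard (Some (size w).+1) true (Some S.-1) true; any_age]
  | inr (Some j) => [:: any_age; exactly j.+1; any_age]
  end.

(** When [c] is [inr _], [update] ignores the neighbours, and they are not read: the content at time
    0 has no left neighbour. *)
Definition sources (t : transition) : seq (content * 'I_3) :=
  match t with
  | inl (l, c, r) =>
      if c is inr _ then [:: (c, middle)]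
      else [:: (l, older); (c, middle); (r, newer)]
  | inr _ => [:: (launch M, middle)]
  end.

Definition target (t : transition) : content :=
  match t with
  | inl (l, c, r) => update l c r
  | inr None => blank M
  | inr (Some j) => inl (None, Some (inl (nth false w j)))
  end.

Definition pre (t : transition) : {mset content * 'I_3} := seq_mset (sources t).

Definition post (t : transition) : {mset content * option 'I_3} :=
  seq_mset ((target t, None) :: [seq (pv.1, Some pv.2) | pv <- sources t]).

Lemma post_var t p x :
  (p, Some x) \in post t -> [exists q, (q, x) \in pre t].
Proof.
rewrite (perm_mem (perm_eq_seq_mset _)) inE => /predU1P[//|/mapP[[q y] src [_ ->]]].
by apply/existsP; exists q; rewrite (perm_mem (perm_eq_seq_mset _)).
Qed.

Definition wave_net : tpn :=
  @TPN content transition 'I_3 (fun t x => nth any_age (guards t) x)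
    pre post post_var.

(** Distinct variables keep the arcs of weight at most 1 even when [l], [c] and [r] coincide. *)
Lemma uniq_sources t : uniq [seq pv.2 | pv <- sources t].
Proof.
case: t => [[[l c] r]|t] //=; case: c => //= c.
by rewrite !inE -!val_eqE /= !inordK.
Qed.

Lemma wave_net_non_consuming : non_consuming wave_net.
Proof.
move=> t p x; rewrite /= !mset_seqE /= count_map; split; last first.
  apply: leq_trans (leq_addl _ _); apply/eq_leq/eq_count => -[q y] /=.
  by rewrite !xpair_eqE.
by rewrite count_uniq_mem ?leq_b1 //; apply: map_uniq (uniq_sources t).
Qed.

(** The chosen transition reads only an [accept] token, of age [S]. *)
Definition wave_instance : instance :=
  @Instance wave_net (launch M) (inl (accept M, accept M, accept M)).

(** * Reachable tokens and the contents they record *)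

Section Semantics.
Variable R : realType.

Notation age := {nonneg R}%R.
Notation marking := {mset content * age}.
Hypothesis lt_wS : (size w).+1 < S.

Let S_gt1 : 1 < S.
Proof. by apply: leq_ltn_trans lt_wS. Qed.

Notation content_at := (content_at M w S).

Local Open Scope ring_scope.
Local Open Scope mset_scope.

Definition nat_age (n : nat) : age := n%:R%:nng.

Lemma in_exactly (m : nat) (c : age) :
  in_guard (exactly m) c = (c%:num == m%:R).
Proof.
by rewrite /in_guard in_itv /= !lee_fin -eq_le eq_sym.
Qed.

Lemma in_any_age (c : age) : in_guard any_age c.
Proof.
rewrite /in_guard in_itv /= lee_fin ltry andbT. exact: ge0.
Qed.

Lemma mem_valuate (V : finType) (rho : V -> age) (B : {mset content * V}) q a :
  reflect (exists2 v, (q, v) \in B & rho v = a)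
    ((q, a) \in valuate (N := wave_net) rho B).
Proof.
rewrite (perm_mem (perm_eq_seq_mset _)).
apply: (iffP mapP) => [[[p v] pB [-> ->]]|[v qB <-]]; first by exists v.
by exists (q, v).
Qed.

Definition token (pi : 'I_3 -> age) (pv : content * 'I_3) := (pv.1, pi pv.2).

Lemma mem_consumed pi (t : transition) q a :
  ((q, a) \in consumed (N := wave_net) pi t) =
  ((q, a) \in [seq token pi pv | pv <- sources t]).
Proof.
apply/mem_valuate/mapP => [[v qv <-]|[[p v] pv [-> ->]]].
  by exists (q, v) => //; rewrite -(perm_mem (perm_eq_seq_mset _)).
by exists v => //; rewrite (perm_mem (perm_eq_seq_mset _)).
Qed.

Lemma mem_produced pi (t : transition) q a :
  ((q, a) \in produced (N := wave_net) pi t) =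
  ((q, a) == (target t, 0%:nng))
  || ((q, a) \in [seq token pi pv | pv <- sources t]).
Proof.
apply/mem_valuate/predU1P => [[v qv <-]|].
  move: qv; rewrite (perm_mem (perm_eq_seq_mset _)) inE.
  case/predU1P => [[-> ->]|/mapP[[p y] pv [-> ->]]]; first by left.
  by right; apply/mapP; exists (p, y).
case=> [[-> ->]|/mapP[[p v] pv [-> ->]]].
  by exists None => //; rewrite (perm_mem (perm_eq_seq_mset _)) inE eqxx.
exists (Some v) => //; rewrite (perm_mem (perm_eq_seq_mset _)) inE.
by apply/predU1P; right; apply/mapP; exists (p, v).
Qed.

(** The sources are put back with their ages, so firing only adds the target to the support. All
    later arguments concern supports, not multiplicities. *)
Lemma mem_fire (X : marking) pi (t : transition) qa :
    consumed (N := wave_net) pi t `<=` X ->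
  (qa \in X `\` consumed (N := wave_net) pi t `+` produced (N := wave_net) pi t) =
  (qa == (target t, 0%:nng)) || (qa \in X).
Proof.
case: qa => q a cX; rewrite in_msetD mem_produced in_msetB.
set src := [seq _ | _ <- _].
have [src_qa | nsrc_qa] := boolP ((q, a) \in src).
  rewrite !orbT; apply/esym/orP; right; apply: msubset_subset cX _ _.
  by rewrite mem_consumed.
rewrite orbF orbC; congr (_ || _); rewrite -mem_consumed -mset_eq0 in nsrc_qa.
by rewrite (eqP nsrc_qa) in_mset.
Qed.

Lemma mem_delay (X : marking) d q a :
  (q, a) \in delay (N := wave_net) d X <->
  exists2 b, (q, b) \in X & a = (b%:num + d%:num)%:nng.
Proof.
rewrite (perm_mem (perm_eq_seq_mset _)).
split=> [/mapP[[p b] pX [-> ->]]|[b qX ->]]; first by exists b.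
by apply/mapP; exists (q, b).
Qed.

(* What a token created at time [tau] may be. The only tokens created at
   non-integer times are blanks. *)
Definition created (tau : R) (q : content) : Prop :=
  (exists2 m : nat, tau = m%:R & q = content_at m) \/
  [/\ 0 <= tau, forall m : nat, tau <> m%:R & q = blank M].

Lemma created_nat (m : nat) q : created m%:R q -> q = content_at m.
Proof.
case=> [[m' /eqP]|[_ /(_ m)//]].
by rewrite eqr_nat => /eqP ->.
Qed.

Lemma created_blank tau q :
  (forall m : nat, tau <> m%:R) -> created tau q -> q = blank M.
Proof. by move=> ntau [[m /ntau]|[]]. Qed.

(** [T] is the current time, common to all tokens, so that [T - a] is the creation time of a token
    of age [a]. *)
Definition sound (X : marking) : Prop :=
  exists T : R, forall q a, (q, a) \in X -> created (T - a%:num) q.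

Lemma guard_older (pi : 'I_3 -> age) l c r :
  (forall x, in_guard (@G wave_net (inl (l, c, r)) x) (pi x)) ->
  [/\ (pi older)%:num = S.+1%:R, (pi middle)%:num = S%:R
    & (pi newer)%:num = S.-1%:R].
Proof.
move=> gP; have := gP older; have := gP middle; have := gP newer.
by rewrite /= !inordK //= !in_exactly => /eqP -> /eqP -> /eqP ->.
Qed.

Lemma guard_middle (pi : 'I_3 -> age) (t : transition) :
  (forall x, in_guard (@G wave_net t x) (pi x)) ->
  in_guard (nth any_age (guards t) 1) (pi middle).
Proof. by move/(_ middle); rewrite /= inordK. Qed.

(** The ages read by a rule differ by integers. Either all creation times are integers and
    [content_atS] applies, or none is, and then sources and target are blanks. In the input
    transitions the age of the [launch] token is [T] itself. *)
Lemma created_target (T : R) (pi : 'I_3 -> age) (t : transition) :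
    (forall x, in_guard (@G wave_net t x) (pi x)) ->
    (forall pv, pv \in sources t -> created (T - (pi pv.2)%:num) pv.1) ->
  created T (target t).
Proof.
case: t => [[[l c] r]|[j|]] gP srcP.
- have [older_ middle_ newer_] := guard_older gP.
  have src_c : (c, middle) \in sources (inl (l, c, r)).
    by case: (c) => ? //=; rewrite !inE eqxx ?orbT.
  have := srcP _ src_c; rewrite /= middle_.
  case=> [[m Tm cm]|[ge0_T nat_T c_blank]].
    left; exists (m + S)%N; first by rewrite natrD -Tm subrK.
    rewrite content_atS // -cm; case: c {gP} => [c|//] in src_c srcP cm *.
    have m_gt0 : (0 < m)%N.
      by case: m cm {Tm} => // ; rewrite content_at0.
    have inl_src pv : pv \in [:: (l, older); (inl c, middle); (r, newer)] ->
      created (T - (pi pv.2)%:num) pv.1 by exact: srcP.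
    have := inl_src (l, older); have := inl_src (r, newer).
    rewrite !inE !eqxx !orbT /= older_ newer_.
    have -> : T = m%:R + S%:R by rewrite -Tm subrK.
    rewrite (_ : m%:R + S%:R - S.-1%:R = m.+1%:R :> R); last first.
      rewrite -natrD -natrB; last by lia.
      by congr (_%:R); lia.
    rewrite (_ : m%:R + S%:R - S.+1%:R = m.-1%:R :> R); last first.
      rewrite -natrD -natrB; last by lia.
      by congr (_%:R); lia.
    by move=> /(_ isT)/created_nat <- /(_ isT)/created_nat <-.
  right; rewrite c_blank /= in srcP *.
  (* As [T - S] is nonnegative, an integer [T] would make it a natural number. *)
  have ntT (k : nat) : T <> k%:R.
    move=> Tk; have le_Sk : (S <= k)%N by rewrite -(ler_nat R) -subr_ge0 -Tk.
    by apply: (nat_T (k - S)%N); rewrite natrB // Tk.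
  have := srcP (l, older); have := srcP (r, newer).
  rewrite !inE !eqxx !orbT /= older_ newer_.
  have shifted (i : nat) (k : nat) : T - i%:R <> k%:R.
    by move/eqP; rewrite subr_eq -natrD => /eqP/ntT.
  move=> /(_ isT)/(created_blank (shifted _)) ->.
  move=> /(_ isT)/(created_blank (shifted _)) ->.
  split=> //; apply: le_trans ge0_T _.
  by rewrite lerBlDr lerDl.
- have := guard_middle gP; rewrite /= in_exactly => /eqP mid.
  have := srcP (launch M, middle); rewrite inE eqxx /= mid => /(_ isT).
  case=> [[m Tm /esym/content_at_launch m0]|[]//].
  left; exists j.+1; first by apply/eqP; rewrite -subr_eq0 Tm m0.
  rewrite content_at_input; last by have := ltn_ord j; lia.
  by rewrite (nth_map false).
have := guard_middle gP; rewrite /= /in_guard in_itv /= !lee_fin.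
have := srcP (launch M, middle); rewrite inE eqxx /= => /(_ isT).
case=> [[m Tm /esym/content_at_launch m0]|[]//].
move/eqP: Tm; rewrite m0 subr_eq add0r => /eqP <- /andP[ge_T le_T].
have [[k Tk]|ntT] := pselect (exists k : nat, T = k%:R); last first.
  right; split=> //; first exact: le_trans ge_T.
  by move=> k Tk; apply: ntT; exists k.
left; exists k => //; rewrite Tk !ler_nat in ge_T le_T.
case: k {Tk} => // k in ge_T le_T *.
rewrite content_at_input; last by lia.
by rewrite nth_default // size_map.
Qed.

Lemma sound_step X Y : step (N := wave_net) X Y -> sound X -> sound Y.
Proof.
case=> [t pi [gP cX] | d] [T XP].
  exists T => q a; rewrite mem_fire // => /predU1P[[-> ->]|/XP//].
  rewrite subr0; apply: created_target gP _ => -[p v] pv.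
  apply/XP/(msubset_subset cX); rewrite mem_consumed; apply/mapP.
  by exists (p, v).
exists (T + d%:num) => q a /mem_delay[b /XP qb ->].
by rewrite /= opprD addrACA subrr addr0.
Qed.

Lemma sound_reach X Y :
  clos_refl_trans _ (step (N := wave_net)) X Y -> sound X -> sound Y.
Proof. by elim=> // [{}X {}Y /sound_step|]; auto. Qed.

(** Distinct ages make the consumed tokens distinct, so having each of them once is enough. *)
Lemma fire (X : marking) (pi : 'I_3 -> age) (t : transition) :
    (forall x, in_guard (@G wave_net t x) (pi x)) ->
    {subset [seq token pi pv | pv <- sources t] <= X} ->
    uniq [seq pi pv.2 | pv <- sources t] ->
  enables (N := wave_net) X t pi.
Proof.
move=> gP srcX uniq_pi; split=> //; apply/msubsetP => -[q a].
have [|] := boolP ((q, a) \in consumed (N := wave_net) pi t); last first.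
  by rewrite -mset_eq0 => /eqP ->.
rewrite mem_consumed => /srcX; rewrite in_mset; apply: leq_trans.
rewrite mset_seqE (permP (perm_map _ (perm_eq_seq_mset _))).
rewrite count_uniq_mem ?leq_b1 //; apply: (@map_uniq _ _ snd).
by rewrite -map_comp.
Qed.

Lemma nat_age_inj : injective nat_age.
Proof.
by move=> m n /(congr1 (fun a : age => a%:num)) /eqP; rewrite eqr_nat => /eqP.
Qed.

Definition back (x : 'I_3) : age := nat_age (S.+1 - x).

Lemma backE : [/\ back older = nat_age S.+1, back middle = nat_age S
  & back newer = nat_age S.-1].
Proof. by split; congr nat_age; rewrite /= ?inordK //; lia. Qed.

Lemma back_inj : injective back.
Proof.
move=> x y /nat_age_inj eq_xy; apply/val_inj.
by have := ltn_ord x; have := ltn_ord y; rewrite /=; lia.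
Qed.

Lemma back_guard l c r (x : 'I_3) :
  in_guard (@G wave_net (inl (l, c, r)) x) (back x).
Proof.
rewrite /back; case: x => -[|[|[]]] //= _; rewrite in_exactly /= eqr_nat; lia.
Qed.

(** Before time [S] the content due is a letter or a blank, read off the age of [launch]; from then
    on a rule computes it from the previous row. *)
Lemma producible (X : marking) (T : nat) : (0 < T)%N ->
    (forall m, (m < T)%N -> (content_at m, nat_age (T - m)) \in X) ->
  exists (t : transition) pi,
    enables (N := wave_net) X t pi /\ target t = content_at T.
Proof.
move=> T_gt0 XP; have [lt_TS | le_ST] := ltnP T S.
  have launchX : (launch M, nat_age T) \in X.
    by rewrite -(content_at0 M w S) -[in nat_age T](subn0 T) XP.
  case: T => // i in T_gt0 lt_TS launchX {XP} *.
  have [lt_iw | le_wi] := ltnP i (size w).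
    exists (inr (Some (Ordinal lt_iw))), (fun=> nat_age i.+1); split; last first.
      by rewrite content_at_input //= (nth_map false).
    apply: fire => // [x|_ /mapP[_ /predU1P[->|//] ->]]; last exact: launchX.
    by case: x => -[|[|[]]] //= _; rewrite ?in_any_age ?in_exactly.
  exists (inr None), (fun=> nat_age i.+1); split; last first.
    by rewrite content_at_input // nth_default // size_map.
  apply: fire => // [x|_ /mapP[_ /predU1P[->|//] ->]]; last exact: launchX.
  case: x => -[|[|[]]] //= _; rewrite ?in_any_age // /in_guard in_itv /=.
  by rewrite !lee_fin !ler_nat ltnS le_wi /=; lia.
have [m defT] : exists m, T = (m + S)%N by exists (T - S)%N; rewrite subnK.
have [older_ middle_ newer_] := backE.
exists (inl (content_at m.-1, content_at m, content_at m.+1)), back.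
split; last by rewrite defT content_atS.
apply: fire => [x|q|]; first exact: back_guard; last first.
  by rewrite map_comp map_inj_uniq ?uniq_sources //; apply: back_inj.
have aged i a : (i < T)%N -> (T - i = a)%N -> (content_at i, nat_age a) \in X.
  by move=> lt_iT <-; apply: XP.
have middleX : (content_at m, back middle) \in X.
  by rewrite middle_; apply: aged; lia.
rewrite /sources; case cm : (content_at m) => [c|c]; last first.
  by case/mapP=> _ /predU1P[->|//] ->; rewrite /token /= -cm.
(* Time 0 holds [launch], so here [m.-1] is a genuine predecessor. *)
have m_gt0 : (0 < m)%N by case: (m) cm => //; rewrite content_at0.
case/mapP=> pv; rewrite !inE => /or3P[] /eqP -> ->; rewrite /token /= -?cm //.
  by rewrite older_; apply: aged; lia.
by rewrite newer_; apply: aged; lia.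
Qed.

(** One initial token suffices, since firing restores what it consumes. The run alternates unit
    delays with the transition that adds the content due. *)
Lemma reach_contents (T : nat) : exists X : marking,
  clos_refl_trans _ (step (N := wave_net)) (msetn 1 (launch M, 0%:nng)) X /\
  forall m, (m <= T)%N -> (content_at m, nat_age (T - m)) \in X.
Proof.
have nat_age0 : nat_age 0 = 0%:nng by apply/val_inj.
elim: T => [|T [X [reachX XP]]].
  exists (msetn 1 (launch M, 0%:nng)); split; first exact: rt_refl.
  by case=> // _; rewrite content_at0 nat_age0 in_msetn eqxx.
pose Y := delay (N := wave_net) (nat_age 1) X.
have YP m : (m < T.+1)%N -> (content_at m, nat_age (T.+1 - m)) \in Y.
  rewrite ltnS => le_mT; apply/mem_delay; exists (nat_age (T - m)); first exact: XP.
  by apply/val_inj; rewrite /= subSn // -addn1 natrD.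
have [t [pi [en_t tgt_t]]] := producible (ltn0Sn T) YP.
exists ((Y `\` consumed (N := wave_net) pi t) `+` produced (N := wave_net) pi t).
split.
  apply: rt_trans reachX _; apply: (rt_trans _ _ _ Y); apply: rt_step.
    exact: step_time.
  exact: step_trans.
case: en_t => _ cY m; rewrite mem_fire // leq_eqVlt => /predU1P[->|/YP->].
  by rewrite subnn nat_age0 tgt_t eqxx.
by rewrite orbT.
Qed.

Lemma ECOVER_wave : ECOVER R wave_instance <-> exists m, content_at m = accept M.
Proof.
split=> [[X [[X0 [X1 [[n X0_] reachX XX1]]] [pi [_ cX]]]]|[m acc_m]].
  have sound0 : sound X0.
    exists 0 => q a; rewrite X0_ => /msetnP[_ [-> ->]]; left; exists 0%N.
      by rewrite subr0.
    by rewrite content_at0.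
  have [T /(_ (accept M) (pi middle))] := sound_reach reachX sound0.
  case=> [|[m _ ->]|[]//]; last by exists m.
  apply/(msubset_subset XX1)/(msubset_subset cX); rewrite mem_consumed /=.
  by rewrite mem_head.
(* The run goes on for [S] units after the creation of [accept], to give its token the age required
   by [back]. *)
have [X [reachX XP]] := reach_contents (m + S).
exists X; split.
  exists (msetn 1 (launch M, 0%:nng)), X; split=> //; last exact: msubset_refl.
  by exists 1.
exists back; have [_ middle_ _] := backE.
apply: (@fire _ _ (inl (accept M, accept M, accept M))) => // [x|q].
  exact: back_guard.
case/mapP=> _ /predU1P[->|//] ->; rewrite /token /= middle_ -acc_m.
by have := XP m; rewrite addKn leq_addr; apply.
Qed.

End Semantics.
End Net.

(** * The code of the net *)

Section Encoding.
Variables (M : tm 1) (a d : nat).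

Notation symbol := (option (bool + aux M)).
Notation content := (option (state M) * symbol + option bool)%type.

(* Each period has room for the border, the input, and a last cell that the head
   never reaches. *)
Definition period (w : seq bool) := size w + (a * size w ^ d + a).+2.

Definition bitcode (s : seq nat) : seq bool := flatten [seq unary n | n <- s].

Lemma bitcode_cat s1 s2 : bitcode (s1 ++ s2) = bitcode s1 ++ bitcode s2.
Proof. by rewrite /bitcode map_cat flatten_cat. Qed.

Lemma bitcode_flatten (T : Type) (f : T -> seq nat) s :
  bitcode (flatten [seq f x | x <- s]) = flatten [seq bitcode (f x) | x <- s].
Proof. by elim: s => //= x s IHs; rewrite bitcode_cat IHs. Qed.

(** This part of the code of a transition does not mention the input: it is a constant once sources
    and target are fixed. *)
Definition arcs_code (src : seq (content * 'I_3)) (tgt : content) : seq nat :=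
  [seq (seq_mset src) (p, x) | p <- enum {: content}, x <- enum 'I_3]
  ++ [seq (seq_mset ((tgt, None) :: [seq (pv.1, Some pv.2) | pv <- src])) (p, v)
     | p <- enum {: content}, v <- enum {: option 'I_3}].

Lemma map_enum_ord (T : Type) n (F : nat -> T) :
  [seq F (nat_of_ord i) | i <- enum 'I_n] = [seq F i | i <- iota 0 n].
Proof. by rewrite -val_enum_ord -map_comp. Qed.

Lemma code_transE w S (t : trans (wave_net M w S)) :
  code_trans t = flatten [seq code_guard g | g <- guards S t]
                 ++ arcs_code (sources t) (target t).
Proof.
rewrite /code_trans /arcs_code; congr (flatten _ ++ _).
rewrite (map_enum_ord 3 (fun i => code_guard (nth any_age (guards S t) i))).
by case: t => [[[l c] r]|[j|]].
Qed.

Notation rule := (content * content * content)%type.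

Lemma enum_transitions n : enum {: rule + option 'I_n} =
  [seq inl t | t <- enum {: rule}]
  ++ inr None :: [seq inr (Some j) | j <- enum 'I_n].
Proof.
rewrite enumT unlock /= /sum_enum -!enumT; congr (_ ++ _).
by rewrite enumT unlock /= /option_enum -enumT -map_comp.
Qed.

Lemma card_transitions n : #|{: rule + option 'I_n}| = #|{: rule}| + n.+1.
Proof. by rewrite card_sum card_option card_ord. Qed.

Lemma flatten_transitions n (f : rule + option 'I_n -> seq nat) :
  flatten [seq f t | t <- enum {: rule + option 'I_n}] =
  flatten [seq f (inl t) | t <- enum {: rule}]
  ++ f (inr None) ++ flatten [seq f (inr (Some j)) | j <- enum 'I_n].
Proof.
rewrite enum_transitions map_cat flatten_cat map_cons.
by rewrite -[in LHS](map_comp f inl) -[in LHS](map_comp f).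
Qed.

Lemma enum_rankE (T : finType) (x : T) :
  nat_of_ord (enum_rank x) = index x (enum T).
Proof.
rewrite /enum_rank enum_rank_in.unlock insubdK //.
by rewrite unfold_in /= cardE index_mem mem_enum.
Qed.

(** The rules are enumerated first, so the rank of the transition to be enabled does not depend on
    the input. *)
Lemma enum_rank_rule n (t : rule) :
  nat_of_ord (enum_rank (inl t : rule + option 'I_n)) = index t (enum {: rule}).
Proof.
rewrite enum_rankE enum_transitions index_cat mem_map ?mem_enum //.
  by rewrite index_map // => ? ? [].
by move=> ? ? [].
Qed.

(** The period takes [d] nested loops; the loop over the letters uses tape [d.+2], and tape [d.+1]
    to print its position twice. *)
Let D := d.+2.

(** The closing [false] of [unary] is left out, so that sums are printed by concatenation. *)
Definition unary_printable (x : seq bool -> nat) :=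
  emits D D (fun w _ => nseq (x w) true).

Definition codable (s : seq bool -> seq nat) :=
  emits D D (fun w _ => bitcode (s w)).

Lemma printable_const n : unary_printable (fun=> n).
Proof. exact: emits_const. Qed.

Lemma printable_add x y :
  unary_printable x -> unary_printable y -> unary_printable (fun w => x w + y w).
Proof.
by move=> cx cy; apply: eq_emits (emits_cat cx cy) => w h _ _; rewrite nseqD.
Qed.

Lemma printable_monomial b e :
  e <= D -> unary_printable (fun w => b * size w ^ e).
Proof. by move=> le_eD; apply: (emitsW le_eD); apply: emits_pow. Qed.

Lemma printable_size : unary_printable size.
Proof.
apply: eq_emits (printable_monomial 1 (ltn0Sn d.+1)) => w h _ _.
by rewrite mul1n.
Qed.

Lemma printable_period : unary_printable period.
Proof.
have := printable_add printable_size (printable_add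
  (printable_monomial a (leqW (leqnSn d))) (printable_const a.+2)).
by apply: eq_emits => w h _ _; rewrite /period !addnS.
Qed.

Lemma codable_const s : codable (fun=> s).
Proof. exact: emits_const. Qed.

Lemma codable_cat s1 s2 :
  codable s1 -> codable s2 -> codable (fun w => s1 w ++ s2 w).
Proof.
by move=> c1 c2; apply: eq_emits (emits_cat c1 c2) => w h _ _; rewrite bitcode_cat.
Qed.

Lemma codable_cons x s :
  unary_printable x -> codable s -> codable (fun w => x w :: s w).
Proof.
move=> cx cs; have cf : emits D D (fun _ _ => [:: false]) by exact: emits_const.
apply: eq_emits (emits_cat cx (emits_cat cf cs)) => w h _ _.
by rewrite /bitcode /= /unary -cats1 -catA.
Qed.

Lemma codable_guards S1 S2 S3 s : unary_printable S1 -> unary_printable S2 ->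
  unary_printable S3 -> codable s ->
  codable (fun w => flatten [seq code_guard g
    | g <- [:: exactly (S1 w); exactly (S2 w); exactly (S3 w)]] ++ s w).
Proof.
move=> c1 c2 c3 cs; rewrite /=.
by do ![apply: codable_cons => //
  | apply: (printable_add (printable_const 1)) | apply: printable_const].
Qed.

(** The guard [exactly j.+1] is coded by [j.+2], 1, [j.+2], 1, while the loop head stands at [j.+1]:
    this position is printed twice, each time after one extra [true]. *)
Lemma codable_inputs (src : seq (content * 'I_3)) (tgt : bool -> content) :
  codable (fun w => flatten [seq
    flatten [seq code_guard g | g <- [:: any_age; exactly j.+1; any_age]]
    ++ arcs_code src (tgt (nth false w j)) | j <- iota 0 (size w)]).
Proof.
have any_ e : emits D e (fun _ _ => bitcode (code_guard any_age) ++ [:: true]).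
  exact: emits_const.
have any2_ e : emits D e (fun _ _ => false :: bitcode (1 :: code_guard any_age)).
  exact: emits_const.
(* The first [false] ends the lower endpoint, [true; false] codes the closed bound, and the last
   [true] starts the upper endpoint. *)
have twice_ := emits_head_twice d [:: false; true; false; true].
have arcs_ e := @emits_letter D e (fun b => bitcode (arcs_code src (tgt b)))
  (ltn0Sn _).
have := emits_for_each (ltnSn d.+1)
  (emits_cat (any_ _) (emits_cat twice_ (emits_cat (any2_ _) (arcs_ _)))).
apply: eq_emits => w h _ _; rewrite bitcode_flatten; congr (flatten _).
apply/eq_in_map => j; rewrite mem_iota add0n => /andP[_ lt_jw].
rewrite [RHS]bitcode_cat.
have -> : letter (marked w ([eta h with d.+2 |-> j.+1] D)) = nth false w j.
  by rewrite /= eqxx /marked /= (nth_map false) // /letter; case: nth.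
move: (bitcode (arcs_code _ _)) => bs; rewrite /= eqxx.
by rewrite /bitcode /= /unary -!cats1 /= -!catA /= -!catA.
Qed.

Lemma codable_instance :
  codable (fun w => code_instance (wave_instance M w (period w))).
Proof.
pose rest w := flatten [seq code_trans (t : trans (wave_net M w (period w)))
                       | t <- enum (trans (wave_net M w (period w)))].
pose tail := [:: index (launch M) (enum {: content});
  index (accept M, accept M, accept M) (enum {: rule})].
(* Sources and targets of rules do not depend on the input word, so they are taken at the empty
   one. *)
have rules_ (t : rule) : codable (fun w => flatten [seq code_guard g
    | g <- [:: exactly (period w).+1; exactly (period w); exactly (period w).-1]]
    ++ arcs_code (sources (w := [::]) (inl t)) (target (w := [::]) (inl t))).
  have cp := printable_period.
  apply: codable_guards; [|exact: cp| |exact: codable_const].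
    exact: printable_add (printable_const 1) cp.
  have := printable_add printable_size (printable_add
    (printable_monomial a (leqW (leqnSn d))) (printable_const a.+1)).
  by apply: eq_emits => w h _ _; rewrite /period !addnS.
have blank_ : codable (fun w => flatten [seq code_guard g
    | g <- [:: any_age;
               Guard (Some (size w).+1) true (Some (period w).-1) true; any_age]]
    ++ arcs_code [:: (launch M, middle)] (blank M)).
  apply: (codable_cat (codable_const (code_guard any_age))).
  do ![apply: codable_cons]; try exact: printable_const.
  - exact: printable_add (printable_const 2) printable_size.
  - apply: eq_emits printable_period => w h _ _.
    by rewrite /period !addnS.
  exact: codable_const.
have inputs_ := codable_inputs [:: (launch M, middle)]
  (fun b => inl (None, Some (inl b))).
have rest_ : codable rest.
  have rules2_ := emits_flatten (enum {: rule}) rules_.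
  apply: eq_emits (emits_cat rules2_ (emits_cat blank_ inputs_)) => w h _ _.
  rewrite -bitcode_flatten -!bitcode_cat; congr bitcode.
  rewrite /rest flatten_transitions; congr (flatten _ ++ (_ ++ flatten _)).
  - by apply: eq_map => -[[l c] r]; rewrite code_transE.
  - by rewrite code_transE.
  rewrite -(map_enum_ord (size w) (fun j => _ ++ _)).
  by apply: eq_map => j; rewrite code_transE.
have ct : unary_printable (fun w => #|{: rule}|.+1 + size w).
  exact: printable_add (printable_const _) printable_size.
have := codable_cons (printable_const #|{: content}|) (codable_cons ct
  (codable_cons (printable_const 3) (codable_cat rest_ (codable_const tail)))).
apply: eq_emits => w h _ _; congr bitcode.
rewrite /code_instance /=.
rewrite enum_rank_rule enum_rankE.
by rewrite card_transitions card_ord addSnnS.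
Qed.

End Encoding.

Theorem theorem7 (R : realType) :
  PSPACE_hard (fun I : nc_instance => encode (sval I))
              (fun I : nc_instance => ECOVER R (sval I)).
Proof.
move=> L [M [a [d decidesL]]].
exists (fun w => exist _ (wave_instance M w (period a d w))
                         (@wave_net_non_consuming M w _)).
split; first exact: emits_polytime (codable_instance M a d).
move=> w /=; have [[m [c [halts_c accL]]] space_w] := decidesL w.
set S := period a d w.
have lt_wS : (size w).+1 < S by rewrite /S /period; lia.
have space k c' : run k (init M w) = Some c' -> (head_pos c' ord0).+2 < S.
  by move=> /space_w/(_ ord0); rewrite /S /period; lia.
rewrite (ECOVER_wave _ _ lt_wS) -accL (accept_row space halts_c).
(* Times and table positions correspond by division by [S]. *)
split=> [[k [j [lt_jS acc]]]|[i acc]].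
  exists (k * S + j).
  by rewrite /content_at divnMDl ?modnMDl ?divn_small ?modn_small ?addn0 //; lia.
exists (i %/ S), (i %% S); split=> //.
by rewrite ltn_mod; lia.
Qed.
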